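(* Let $p$ be an odd prime and $m\ge1$. For $d\mid\frac{\phi(p^m)}{2}$ put $g_k(d)=\gcd\!\left(d,\frac{\phi(p^{m-k})}{2}\right)$, $U_d(x)=\left(1+x^{\frac{\phi(p^m)}{d}}\right)^{d}$ and $P_d(x)=\prod_{k=1}^{m-1}\left(1+x^{\frac{\phi(p^{m-k})}{g_k(d)}}\right)^{g_k(d)}$ (empty product $=1$). Then $$\Psi^w_{\mathbb{Z}_{2p^m}}(x)=\frac{2}{p^{m-1}(p-1)}\sum_{d\mid\frac{\phi(p^m)}{2}}\phi\!\left(\frac{\phi(p^m)}{2d}\right)\Big[(U_d(x)-1)\,U_d(x)\,P_d(x)^2(1+x)+(U_d(x)-1)\big(P_d(x)(1+x)-1\big)P_d(x)\Big],$$ and hence $$\mathcal{E}^w(\mathbb{Z}_{2p^m})=\frac{2}{p^{m-1}(p-1)}\sum_{d\mid\frac{\phi(p^m)}{2}}\phi\!\left(\frac{\phi(p^m)}{2d}\right)\Big[2^{d+1}(2^d-1)\prod_{k=1}^{m-1}2^{2g_k(d)}+(2^d-1)\Big(2\prod_{k=1}^{m-1}2^{g_k(d)}-1\Big)\prod_{k=1}^{m-1}2^{g_k(d)}\Big].$$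
   Context: $\phi$ is Euler's totient function. For a finite group $\mathcal{A}$ with identity $e$, let $G(\mathcal{A})=\{\Omega\subseteq\mathcal{A}:\Omega^{-1}=\Omega,\ \langle\Omega\rangle=\mathcal{A},\ e\notin\Omega\}$. $\mathrm{Aut}(\mathcal{A})$ acts on $G(\mathcal{A})$ by $\alpha\cdot\Omega=\alpha(\Omega)$. For $k\ge1$ let $a^w_k(\mathcal{A})$ be the number of orbits of $\mathrm{Aut}(\mathcal{A})$ on $\{\Omega\in G(\mathcal{A}):|\Omega|=k\}$ (the number of weak equivalence classes of Cayley graphs $C(\mathcal{A},\Omega)$ of degree $k$); $\Psi^w_{\mathcal{A}}(x)=\sum_{k=1}^{|\mathcal{A}|-1}a^w_k(\mathcal{A})x^k$ and $\mathcal{E}^w(\mathcal{A})=\Psi^w_{\mathcal{A}}(1)$. For cyclic groups $\mathbb{Z}_n$, $\mathrm{Aut}(\mathbb{Z}_n)$ consists of multiplications by units mod $n$. *)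

(* Defs.v *)
From HB Require Import structures.
From mathcomp Require Import all_boot all_order all_algebra all_fingroup.
Set Implicit Arguments. Unset Strict Implicit. Unset Printing Implicit Defensive.
Import GRing.Theory.

Local Open Scope group_scope.

Definition Gset (gT : finGroupType) : {set {set gT}} :=
  [set Om : {set gT} | [&& Om^-1 == Om, <<Om>> == [set: gT] & 1 \notin Om]].

Definition awk (gT : finGroupType) (k : nat) : nat :=
  #|orbit 'P^*%act (Aut [set: gT]) @: [set Om in Gset gT | #|Om| == k]%N|.

Local Close Scope group_scope.
Local Open Scope ring_scope.

Definition Psiw (gT : finGroupType) : {poly rat} :=
  \sum_(1 <= k < #|gT|) (awk gT k)%:R *: 'X^k.

Definition Ew (gT : finGroupType) : rat := (Psiw gT).[1].

Definition gk (p m k d : nat) : nat := gcdn d ((totient (p ^ (m - k))) %/ 2).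

Definition Ud (p m d : nat) : {poly rat} :=
  (1 + 'X^(totient (p ^ m) %/ d)) ^+ d.

Definition Pd (p m d : nat) : {poly rat} :=
  \prod_(1 <= k < m) (1 + 'X^(totient (p ^ (m - k)) %/ gk p m k d)) ^+ gk p m k d.

(* Main.v *)
(* Let W be the automorphism group of the cyclic group of order 2p^m, cyclic of
   order N = phi(p^m).  By the Cauchy-Frobenius lemma, N times the series is the
   sum over a in W of the generating function of the connection sets stable
   under a, that is, of the generating sets without identity stable under
   H = <a, inversion>.  A set generates iff it is contained in neither maximal
   subgroup, so inclusion-exclusion reduces to counting H-stable subsets of four
   sets of the form {x <> 1 : #[x] | t}.  If H has index d in W, the phi(e)
   elements of order e split into gcd(d, phi(e)) H-orbits of equal size, since
   |HK| = lcm(|H|, |K|) for subgroups of the cyclic group W.  Finally, a = w^i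
   with W = <w> gives d = gcd(i, N/2), and phi(N/(2d)) residues i modulo N/2
   have this gcd. *)
Require Import Defs.
From HB Require Import structures.
From mathcomp Require Import all_boot all_order all_algebra all_fingroup.
From mathcomp Require Import cyclic pgroup extremal.
From mathcomp Require Import ring.
Import GRing.Theory.
Local Open Scope ring_scope.

Set Implicit Arguments.
Unset Strict Implicit.
Unset Printing Implicit Defensive.

(** * Generating functions, by cardinality, of the subsets stable under a group action *)

Definition stable_gf (R : comNzRingType) (z : R) (aT : finGroupType)
    (T : finType) (to : {action aT &-> T}) (A : {set aT}) (S : {set T}) : R :=
  \sum_(Om : {set T} | (Om \subset S) && [acts A, on Om | to]%g) z ^+ #|Om|.

Section StableGf.
Variables (R : comNzRingType) (z : R) (aT : finGroupType) (T : finType).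
Variables (to : {action aT &-> T}) (H : {group aT}).
Implicit Type S : {set T}.
Local Notation gf := (stable_gf z to H).

Lemma stable_gf0 : gf set0 = 1.
Proof.
rewrite /stable_gf (big_pred1 set0) ?cards0 // => Om; rewrite subset0 /=.
case: eqP => [->|_] //=; apply/actsP=> a _ x; by rewrite !inE.
Qed.

(** A stable subset of the union is determined by its traces on [S1] and [S2], which are stable,
    arbitrary, and have cardinalities adding up. *)
Lemma stable_gfU S1 S2 :
    [acts H, on S1 | to]%g -> [acts H, on S2 | to]%g -> [disjoint S1 & S2] ->
  gf (S1 :|: S2) = gf S1 * gf S2.
Proof.
move=> H1 H2 dis; rewrite /stable_gf big_distrlr /= pair_big /=.
have capE (A B : {set T}) : A \subset S1 -> B \subset S2 ->
    ((A :|: B) :&: S1 = A) * ((A :|: B) :&: S2 = B).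
  move=> sA sB; rewrite !setIUl (setIidPl sA) (setIidPl sB).
  have -> : B :&: S1 = set0.
    apply/eqP; rewrite setI_eq0 disjoint_sym; exact: disjointWr sB dis.
  have -> : A :&: S2 = set0.
    apply/eqP; rewrite setI_eq0; exact: disjointWl sA dis.
  by rewrite setU0 set0U.
symmetry.
rewrite (reindex_onto (fun Om => (Om :&: S1, Om :&: S2)) (fun q => q.1 :|: q.2)).
  apply: eq_big => [Om|Om] /=.
    apply/andP/andP.
      case=> /andP[/andP[_ a1] /andP[_ a2]] /eqP <-.
      by rewrite setUSS ?subsetIr // actsU.
    case=> sOm aOm; rewrite -setIUr (setIidPl sOm) eqxx; split=> //.
    by rewrite !subsetIr !actsI.
  case/andP=> /andP[/andP[_ a1] /andP[_ a2]] /eqP e.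
  rewrite -{3}e -exprD cardsU.
  by rewrite setIACA (disjoint_setI0 dis) setI0 cards0 subn0.
case=> A B /= /andP[/andP[sA _] /andP[sB _]].
by rewrite !capE.
Qed.

(** The action on an orbit is transitive, so only the empty set and the full orbit are stable. *)
Lemma stable_gf_orbit x : gf (orbit to H x) = 1 + z ^+ #|orbit to H x|.
Proof.
rewrite /stable_gf (bigD1 set0) /=; last first.
  by rewrite sub0set; apply/actsP=> a _ y; rewrite !inE.
rewrite cards0 expr0 (big_pred1 (orbit to H x)) // => Om /=.
apply/andP/eqP => [[/andP[sOm aOm]]|->].
  case/set0Pn=> y yOm; apply/eqP; rewrite eqEsubset sOm.
  have /orbit_eqP <- := subsetP sOm _ yOm.
  by rewrite acts_sub_orbit.
rewrite subxx acts_orbit ?subsetT //; split=> //.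
by apply/set0Pn; exists x; apply: orbit_refl.
Qed.

(** [S] consists of [#|S| %/ s] orbits, each giving a factor [1 + z ^+ s]; the induction removes one
    orbit at a time. *)
Lemma stable_gf_const s S :
    [acts H, on S | to]%g -> {in S, forall x, #|orbit to H x| = s} ->
  gf S = (1 + z ^+ s) ^+ (#|S| %/ s).
Proof.
have [k] := ubnP #|S|; elim: k S => // k IHk S ltSk aS oS.
have [->|[x Sx]] := set_0Vmem S; first by rewrite stable_gf0 cards0 div0n.
have aO : [acts H, on orbit to H x | to]%g by rewrite acts_orbit ?subsetT.
have sO : orbit to H x \subset S by rewrite acts_sub_orbit.
have os := oS _ Sx.
have s_gt0 : (0 < s)%N.
  by rewrite -os; apply/card_gt0P; exists x; apply: orbit_refl.
have cS : #|S| = (s + #|S :\: orbit to H x|)%N.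
  by rewrite -(cardsID (orbit to H x) S) (setIidPr sO) os.
rewrite -{1}(setID S (orbit to H x)) (setIidPr sO) stable_gfU ?actsD //; last first.
  by rewrite -setI_eq0 setDE setICA setICr setI0.
rewrite stable_gf_orbit os IHk ?actsD //.
- by rewrite cS divnDl ?divnn ?s_gt0 ?exprS ?dvdnn.
- by rewrite -ltnS (leq_trans _ ltSk) // ltnS [leqRHS]cS -addn1 addnC leq_add2r.
by move=> y /setDP[Sy _]; apply: oS.
Qed.

End StableGf.

(** * Arithmetic of gcds and divisor sums *)

(** Taking complementary divisors reverses divisibility among the divisors of [N], hence exchanges
    gcd and lcm. *)
Lemma lcmn_div N a b : (0 < N -> a %| N -> b %| N ->
  lcmn (N %/ a) (N %/ b) = N %/ gcdn a b)%N.
Proof.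
move=> N0 aN bN.
have a0 := dvdn_gt0 N0 aN; have b0 := dvdn_gt0 N0 bN.
have g0 : (0 < gcdn a b)%N by rewrite gcdn_gt0 a0.
have /dvdnP[c Nc] : (lcmn a b %| N)%N by rewrite dvdn_lcm aN.
apply/eqP; rewrite -(eqn_pmul2r g0) divnK ?(dvdn_trans (dvdn_gcdl _ _)) //.
have -> : (N %/ a = c * (lcmn a b %/ a))%N by rewrite Nc muln_divA ?dvdn_lcml.
have -> : (N %/ b = c * (lcmn a b %/ b))%N by rewrite Nc muln_divA ?dvdn_lcmr.
have -> : (lcmn a b %/ a = b %/ gcdn a b)%N.
  by apply/eqP; rewrite eq_sym eqn_div ?dvdn_lcml // -(eqn_pmul2r g0) muln_lcm_gcd mulnAC
     divnK ?dvdn_gcdr // mulnC.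
have -> : (lcmn a b %/ b = a %/ gcdn a b)%N.
  by apply/eqP; rewrite eq_sym eqn_div ?dvdn_lcmr // -(eqn_pmul2r g0) muln_lcm_gcd mulnAC
     divnK ?dvdn_gcdl.
rewrite -muln_lcmr -mulnA muln_lcml !divnK ?dvdn_gcdl ?dvdn_gcdr //.
by rewrite lcmnC Nc.
Qed.

(** The [i] below [M] with [gcdn i M = d] are the [j * d] with [j] below [M %/ d] and coprime to
    it. *)
Lemma sum_gcdn (V : nmodType) (F : nat -> V) M : (0 < M)%N ->
  \sum_(0 <= i < M) F (gcdn i M) =
  \sum_(d <- divisors M) F d *+ totient (M %/ d).
Proof.
move=> M0.
have key d : (d %| M)%N ->
    perm_eq [seq i <- index_iota 0 M | gcdn i M == d]
            [seq (j * d)%N | j <- index_iota 0 (M %/ d) & coprime (M %/ d) j].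
  move=> dM; have d0 := dvdn_gt0 M0 dM.
  apply: uniq_perm.
  - by rewrite filter_uniq ?iota_uniq.
  - rewrite map_inj_uniq ?filter_uniq ?iota_uniq // => i j /eqP.
    by rewrite eqn_pmul2r // => /eqP.
  move=> i; rewrite mem_filter mem_index_iota.
  apply/andP/mapP => [[/eqP g /= lti]|[j]].
    have di : (d %| i)%N by rewrite -g dvdn_gcdl.
    exists (i %/ d)%N; last by rewrite divnK.
    rewrite mem_filter mem_index_iota ltn_divRL // divnK //= lti andbT.
    by rewrite /coprime -(eqn_pmul2r d0) muln_gcdl !divnK // gcdnC g mul1n.
  rewrite mem_filter mem_index_iota /= ltn_divRL // => /andP[cop lt] ->.
  split=> //; rewrite -{1}(divnK dM) -muln_gcdl gcdnC.
  by rewrite (eqP cop) mul1n.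
transitivity (\sum_(0 <= i < M) \sum_(d <- divisors M | d == gcdn i M) F d).
  apply: eq_bigr => i _; rewrite -big_filter.
  rewrite (_ : [seq d <- divisors M | d == gcdn i M] = [:: gcdn i M]) ?big_seq1 //.
  rewrite (filter_pred1_uniq (divisors_uniq M)) //.
  by rewrite -dvdn_divisors ?dvdn_gcdr.
rewrite (exchange_big_dep predT) //= big_seq [RHS]big_seq.
apply: eq_bigr => d; rewrite -dvdn_divisors // => dM.
rewrite big_const_seq iter_addr_0; congr (_ *+ _).
rewrite totient_count_coprime -big_mkcond sum1_count -!size_filter.
under eq_filter do rewrite eq_sym.
by rewrite (perm_size (key d dM)) size_map.
Qed.

(** The gcd with [M] is [M]-periodic. This serves exponents modulo the order of the automorphism
    group when the gcd is taken with half that order. *)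
Lemma sum_gcdn_double (V : nmodType) (F : nat -> V) M : (0 < M)%N ->
  \sum_(0 <= i < M.*2) F (gcdn i M) =
  (\sum_(d <- divisors M) F d *+ totient (M %/ d)) *+ 2.
Proof.
move=> M0; rewrite -sum_gcdn // (@big_cat_nat _ _ _ M) /= -?addnn ?leq_addr //.
rewrite mulr2n; congr (_ + _).
rewrite -{1}[M]add0n big_addn addnK.
by apply: eq_bigr => i _; rewrite gcdnC gcdnDr gcdnC.
Qed.

(** * Subgroups of a cyclic group and their orbits *)

Section Cyclic.
Local Open Scope group_scope.
Variables (gT : finGroupType) (G H K : {group gT}).
Hypotheses (cG : cyclic G) (sHG : H \subset G) (sKG : K \subset G).

(** In a cyclic group inclusion of subgroups is divisibility of orders, so the subgroup [L] of order
    the gcd lies in both [H] and [K]. *)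
Lemma card_setI_cyclic : #|H :&: K| = gcdn #|H| #|K|.
Proof.
apply/eqP; rewrite eqn_dvd dvdn_gcd !cardSg ?subsetIl ?subsetIr //=.
case/cyclicP: (cG) => x defG.
have dx : (gcdn #|H| #|K| %| #[x]%g)%N.
  by rewrite orderE -defG (dvdn_trans (dvdn_gcdl _ _)) // cardSg.
set L := <[x ^+ (#[x] %/ gcdn #|H| #|K|)]>%G.
have cL : #|L| = gcdn #|H| #|K|.
  by rewrite -orderE orderXdiv ?dvdn_div // divnA // mulKn // order_gt0.
have sLG : L \subset G by rewrite defG cycleX.
rewrite -cL cardSg // subsetI.
rewrite -(cardSg_cyclic cG) // -[X in _ && X](cardSg_cyclic cG) // cL.
by rewrite dvdn_gcdl dvdn_gcdr.
Qed.

Lemma card_mul_cyclic : #|(H * K)%g| = lcmn #|H| #|K|.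
Proof.
have g0 : (0 < gcdn #|H| #|K|)%N by rewrite gcdn_gt0 cardG_gt0.
apply/eqP; rewrite -(eqn_pmul2r g0) muln_lcm_gcd -card_setI_cyclic.
by rewrite mul_cardG.
Qed.
End Cyclic.

(** With [C] the stabilizer of [x] in [W], the [H]-orbit has [#|H| / #|H :&: C| = #|H * C| / #|C|]
    points, and [#|H * C|] is the lcm of two complementary divisors of [#|W|]. *)
Lemma card_orbit_cyclic (aT : finGroupType) (T : finType)
    (to : {action aT &-> T}) (H W : {group aT}) (x : T) :
    cyclic W -> H \subset W ->
  #|orbit to H x|
   = (#|orbit to W x| %/ gcdn #|W : H|%g #|orbit to W x|)%N.
Proof.
move=> cW sHW; set o := #|orbit to W x|.
have o0 : (0 < o)%N by apply/card_gt0P; exists x; apply: orbit_refl.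
have N0 := cardG_gt0 W.
have oW : (o * #|'C_W[x | to]%g| = #|W|)%N by apply: card_orbit_stab.
have cC : #|'C_W[x | to]%g| = (#|W| %/ o)%N by rewrite -oW mulKn.
have dW : (o %| #|W|)%N by rewrite -oW dvdn_mulr.
have cH : #|H| = (#|W| %/ #|W : H|%g)%N by rewrite -(Lagrange sHW) mulnK // indexg_gt0.
have g0 : (0 < gcdn #|W : H|%g o)%N by rewrite gcdn_gt0 o0 orbT.
have C0 : (0 < #|'C_W[x | to]%g|)%N by apply: cardG_gt0.
have sC : 'C_H[x | to]%g = H :&: 'C_W[x | to]%g by rewrite setIA (setIidPl sHW).
have E1 := card_orbit_stab to H x; rewrite /= sC in E1.
have := mul_cardG H ('C_W[x | to])%G.
rewrite (card_mul_cyclic cW) ?subsetIl //= -{1}E1.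
rewrite mulnAC => /eqP; rewrite eqn_pmul2r ?cardG_gt0 // cC cH lcmn_div ?dvdn_indexg //.
rewrite -cC => /eqP E2; apply/eqP; rewrite eqn_div ?dvdn_gcdr //.
rewrite -(eqn_pmul2r C0) oW mulnAC E2.
by rewrite divnK // (dvdn_trans (dvdn_gcdr _ _)).
Qed.

(** * Automorphisms of a cyclic group and their orbits *)

(** Units modulo [e] lift to units modulo [n]: by the Chinese remainder theorem, take [u] modulo the
    part of [n] built on the primes of [e], and 1 modulo the rest. *)
Lemma coprime_lift u e n : (0 < n -> e %| n -> coprime u e ->
  exists2 v, coprime v n & v = u %[mod e])%N.
Proof.
move=> n0 en cop.
have e0 := dvdn_gt0 n0 en.
set pi := \pi(e); set n1 := (n`_pi)%N; set n2 := (n`_pi^')%N.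
have co12 : coprime n1 n2 by rewrite coprime_partC.
have n10 : (0 < n1)%N := part_gt0 _ _.
have e1 : (e %| n1)%N by rewrite -(part_pnat_id (pnat_pi e0)) partn_dvd.
exists (chinese n1 n2 u 1).
  rewrite -(partnC pi n0) coprimeMr -!(coprime_modl (chinese _ _ _ _)).
  rewrite chinese_modl // chinese_modr // !coprime_modl coprime1n andbT.
  (* If [u = 0], coprimality forces [e = 1], and then [n1 = 1]. *)
  rewrite coprime_sym; have [u0|u_gt0] := posnP u.
    move: cop; rewrite /n1 /pi u0 /coprime gcd0n gcdn0 => /eqP->.
    by rewrite part_p'nat // -coprime_pi' // coprime1n.
  by apply: (@pnat_coprime pi); rewrite ?part_pnat // -coprime_pi' // coprime_sym.
by rewrite -(modn_dvdm _ e1) chinese_modl // modn_dvdm.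
Qed.

Section CyclicAut.
Local Open Scope group_scope.
Variables (gT : finGroupType).
Hypothesis cG : cyclic [set: gT].

(** The power map is a morphism by commutativity, and injective because an element it kills has
    order dividing [gcdn u #|gT| = 1]. *)
Lemma Aut_power u : coprime u #|gT| ->
  exists2 a, a \in Aut [set: gT] & forall x, a x = x ^+ u.
Proof.
move=> cop; have abG := cyclic_abelian cG.
have fM : {in [set: gT] &, {morph (fun x : gT => x ^+ u) : x y / x * y}}.
  by move=> x y _ _ /=; apply: expgMn; apply: (centsP abG); rewrite inE.
pose f := Morphism fM.
have injf : 'injm f.
  apply/subsetP=> x /setIdP[_]; rewrite !inE -order_dvdn -order_eq1 -dvdn1 => xu.
  by rewrite -(eqP cop) dvdn_gcd xu -cardsT order_dvdG ?inE.
have imf : f @* [set: gT] = [set: gT].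
  by apply/eqP; rewrite eqEcard subsetT card_injm /=.
exists (aut injf imf); first exact: Aut_aut.
by move=> x; rewrite autE ?inE.
Qed.

Lemma eq_order_cyclic (x y : gT) : #[x] = #[y] -> <[x]> = <[y]>.
Proof.
by move=> exy; apply/eqP; rewrite (eq_subG_cyclic cG) ?subsetT //; apply/eqP.
Qed.

Lemma card_order_eq (x : gT) : #|[set y : gT | #[y] == #[x]]| = totient #[x].
Proof.
rewrite totient_gen; apply: eq_card => y; rewrite !inE /generator.
apply/eqP/eqP => [/esym|exy]; first exact: eq_order_cyclic.
by rewrite !orderE exy.
Qed.

(** Elements of equal order generate the same subgroup, so [y = x ^+ u] with [u] a unit modulo
    [#[x]]; lifting [u] modulo the group order makes this power map an automorphism. *)
Lemma orbit_Aut (x : gT) :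
  orbit 'P (Aut [set: gT]) x = [set y : gT | #[y] == #[x]].
Proof.
apply/setP=> y; rewrite inE; apply/orbitP/eqP => [[a Aa <-]|oy].
  by rewrite /= apermE -(autmE Aa) order_injm ?injm_autm ?inE.
have /cycleP[u yu] : y \in <[x]> by rewrite -(eq_order_cyclic oy) cycle_id.
have cop : coprime u #[x].
  have := generator_coprime x u; rewrite coprime_sym => <-.
  by rewrite /generator -yu (eq_order_cyclic oy).
have n_gt0 : (0 < #|gT|)%N by apply/card_gt0P; exists 1.
have dx : (#[x]%g %| #|gT|)%N by rewrite -cardsT order_dvdG ?inE.
have [v copv evu] := coprime_lift n_gt0 dx cop.
have [a Aa ae] := Aut_power copv; exists a => //=.
rewrite apermE ae yu; apply/eqP; rewrite eq_expg_mod_order; exact/eqP.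
Qed.

Lemma card_orbit_Aut (x : gT) : #|orbit 'P (Aut [set: gT]) x| = totient #[x].
Proof. by rewrite orbit_Aut card_order_eq. Qed.

Lemma stable_gf_order (R : comNzRingType) (z : R) (H : {group {perm gT}}) (x : gT) :
    H \subset Aut [set: gT] -> cyclic (Aut [set: gT]) ->
  let g := gcdn #|Aut [set: gT] : H| (totient #[x]) in
  stable_gf z 'P H [set y : gT | #[y] == #[x]]
   = ((1 + z ^+ (totient #[x] %/ g)) ^+ g)%R.
Proof.
move=> sHA cA g.
have aS : [acts H, on [set y : gT | #[y] == #[x]] | 'P].
  by rewrite (subset_trans sHA) // -orbit_Aut acts_orbit ?subsetT.
have t0 : (0 < totient #[x])%N by rewrite totient_gt0 order_gt0.
have g0 : (0 < g)%N by rewrite gcdn_gt0 t0 orbT.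
rewrite (@stable_gf_const _ _ _ _ _ _ (totient #[x] %/ g)%N) //.
  rewrite card_order_eq divnA ?dvdn_gcdr // mulKn //.
move=> y; rewrite inE => /eqP oy.
by rewrite (@card_orbit_cyclic _ _ _ _ (Aut [set: gT])%G) //= card_orbit_Aut oy.
Qed.

End CyclicAut.

(** * Stable sets of elements with prescribed orders *)

Lemma totient_double q : odd q -> totient (2 * q) = totient q.
Proof. by move=> oq; rewrite totient_coprime ?coprime2n // mul1n. Qed.

Section OrderSets.
Local Open Scope group_scope.
Variables (gT : finGroupType).
Hypothesis cG : cyclic [set: gT].
Hypothesis cA : cyclic (Aut [set: gT]).

Lemma exists_order e : (e %| #|gT|)%N -> exists x : gT, #[x] = e.
Proof.
move=> en; case/cyclicP: cG => x defG.
have ox : #[x] = #|gT| by rewrite orderE -defG cardsT.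
have n0 : (0 < #|gT|)%N by rewrite -ox order_gt0.
exists (x ^+ (#|gT| %/ e)); rewrite orderXdiv ox ?dvdn_div //.
by rewrite divnA // mulKn.
Qed.

Variables (R : comNzRingType) (z : R) (H : {group {perm gT}}).
Hypothesis sHA : H \subset Aut [set: gT].

(* The contribution of the elements of order [e] when [H] has index [d]. *)
Definition order_factor (d e : nat) : R :=
  ((1 + z ^+ (totient e %/ gcdn d (totient e))) ^+ gcdn d (totient e))%R.

Lemma acts_order (P : pred nat) : [acts H, on [set x : gT | P #[x]] | 'P].
Proof.
apply/actsP=> a /(subsetP sHA) Aa x; rewrite !inE /= apermE.
by rewrite -(autmE Aa) order_injm ?injm_autm ?inE.
Qed.

(** Classes of elements of different orders are disjoint and [H]-stable, so their generating
    functions multiply. *)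
Lemma stable_gf_orders (s : seq nat) :
    uniq s -> all (fun e => e %| #|gT|)%N s ->
  stable_gf z 'P H [set x : gT | #[x] \in s]
   = (\prod_(e <- s) order_factor #|Aut [set: gT] : H| e)%R.
Proof.
elim: s => [|e s IHs] /=.
  move=> _ _; rewrite big_nil.
  by rewrite (_ : [set _ | _] = set0) ?stable_gf0 //; apply/setP=> x; rewrite !inE.
case/andP=> es us /andP[en sn]; rewrite big_cons -IHs //.
have [x ox] := exists_order en.
have -> : [set x : gT | #[x] \in e :: s]
    = [set y : gT | #[y] == #[x]] :|: [set x : gT | #[x] \in s].
  by apply/setP=> y; rewrite !inE ox.
rewrite stable_gfU ?(acts_order (fun o => o == #[x])) ?(acts_order (mem s)) //.
  by rewrite stable_gf_order // ox.
rewrite -setI_eq0; apply/eqP/setP=> y; rewrite !inE ox.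
by apply/negP => /andP[/eqP->]; apply/negP.
Qed.

(** When [t] divides the order of the cyclic group, this is its unique subgroup of order [t]
    deprived of 1. *)
Definition dvd_orders t : {set gT} := [set x | (x != 1) && (#[x] %| t)%N].

Lemma dvd_ordersE t (s : seq nat) : s =i [pred e | (e != 1%N) && (e %| t)%N] ->
  dvd_orders t = [set x : gT | #[x] \in s].
Proof. by move=> sE; apply/setP=> x; rewrite !inE sE !inE order_eq1. Qed.

End OrderSets.

Section TwicePrimePower.
Local Open Scope group_scope.
Variables (p : nat).
Hypotheses (hp : prime p) (hodd : odd p).
Variables (gT : finGroupType).
Hypothesis cG : cyclic [set: gT].
Variables (R : comNzRingType) (z : R) (H : {group {perm gT}}).
Hypothesis cA : cyclic (Aut [set: gT]).
Hypothesis sHA : H \subset Aut [set: gT].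
Let d := #|Aut [set: gT] : H|.

Lemma stable_gf_ppow j : (p ^ j %| #|gT|)%N ->
  stable_gf z 'P H (dvd_orders gT (p ^ j))
   = (\prod_(0 <= i < j) order_factor z d (p ^ i.+1))%R.
Proof.
move=> jn; pose s := [seq (p ^ i.+1)%N | i <- index_iota 0 j].
have p1 := prime_gt1 hp.
rewrite (@dvd_ordersE _ _ s).
  rewrite stable_gf_orders ?big_map //.
    by rewrite map_inj_uniq ?iota_uniq // => a b /eqP; rewrite eqn_exp2l // => /eqP[].
  apply/allP=> e /mapP[i]; rewrite mem_index_iota => /= lti ->.
  by apply: dvdn_trans jn; rewrite dvdn_exp2l.
move=> e; rewrite !inE; apply/mapP/andP => [[i]|[e1 /(dvdn_pfactor _ _ hp)[[|i] li ee]]].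
- rewrite mem_index_iota => /= lti ->; rewrite dvdn_exp2l //; split=> //.
  by rewrite -(expn0 p) eqn_exp2l.
- by rewrite ee in e1.
by exists i => //; rewrite mem_index_iota.
Qed.

(** The divisors other than 1 are the [p ^ i.+1] with [i < j] and the [2 * p ^ i] with [i <= j].
    Doubling an odd number keeps its totient, whence the square; the order 2 alone gives [1 + z]. *)
Lemma stable_gf_2ppow j : (2 * p ^ j %| #|gT|)%N ->
  stable_gf z 'P H (dvd_orders gT (2 * p ^ j))
   = ((\prod_(0 <= i < j) order_factor z d (p ^ i.+1)) ^+ 2 * (1 + z))%R.
Proof.
move=> jn.
pose s1 := [seq (p ^ i.+1)%N | i <- index_iota 0 j].
pose s2 := [seq (2 * p ^ i)%N | i <- index_iota 0 j.+1].
have p1 := prime_gt1 hp.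
rewrite (@dvd_ordersE _ _ (s1 ++ s2)).
  rewrite stable_gf_orders //.
  - rewrite big_cat !big_map /= [in X in (_ * X)%R]big_nat_recl //= expn0.
    rewrite /order_factor (totient_double (q := 1)) // gcdn1 divnn !expr1.
    rewrite expr2 -mulrA; congr (_ * _)%R; rewrite mulrC; congr (_ * _)%R.
    by apply: eq_bigr => i _; rewrite totient_double ?oddX ?hodd ?orbT.
  - rewrite cat_uniq; apply/and3P; split.
    + by rewrite map_inj_uniq ?iota_uniq // => a b /eqP; rewrite eqn_exp2l // => /eqP[].
    + apply/hasPn=> _ /mapP[i _ ->]; apply/negP=> /mapP[k _ /(congr1 odd)].
      by rewrite oddM /= oddX hodd orbT.
    rewrite map_inj_uniq ?iota_uniq // => a b /eqP.
    by rewrite eqn_pmul2l // eqn_exp2l // => /eqP.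
  rewrite all_cat; apply/andP; split; apply/allP=> e /mapP[i];
    rewrite mem_index_iota => /= lti ->; apply: dvdn_trans jn.
    by rewrite dvdn_mull // dvdn_exp2l.
  by rewrite dvdn_pmul2l // dvdn_exp2l.
move=> e; rewrite mem_cat [RHS]inE.
have dv k : odd k -> (k %| 2 * p ^ j)%N = (k %| p ^ j)%N.
  by move=> ok; rewrite Gauss_dvdr // coprimen2.
apply/orP/andP => [[/mapP[i] | /mapP[i]] | [e1 de]].
- rewrite mem_index_iota => /= lti ->; rewrite dvdn_mull ?dvdn_exp2l //; split=> //.
  by rewrite -(expn0 p) eqn_exp2l.
- rewrite mem_index_iota => /= lti ->; rewrite dvdn_pmul2l // dvdn_exp2l //.
  by split=> //; apply/negP=> /eqP/(congr1 odd); rewrite oddM.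
have [oe|] := boolP (odd e).
  move: de; rewrite dv // => /(dvdn_pfactor _ _ hp)[[|i] li ee];
    first by rewrite ee in e1.
  by left; apply/mapP; exists i => //; rewrite mem_index_iota.
rewrite -dvdn2 => /dvdnP[k ek]; move: de; rewrite ek mulnC dvdn_pmul2l //.
case/(dvdn_pfactor _ _ hp)=> i li ->; right; apply/mapP; exists i => //.
by rewrite mem_index_iota.
Qed.

End TwicePrimePower.

(** * The automorphism group of the cyclic group of order 2p^m *)

Section AutCyclic.
Local Open Scope group_scope.
Variables (p m : nat).
Hypotheses (hp : prime p) (hodd : odd p) (hm : (0 < m)%N).
Variable gT : finGroupType.
Hypothesis cG : cyclic [set: gT].
Hypothesis cgT : #|gT| = (2 * p ^ m)%N.

Lemma Aut_pgroup_cyclic (hT : finGroupType) (M : {group hT}) :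
  p.-group M -> cyclic M -> M :!=: 1 -> cyclic (Aut M).
Proof.
move=> pM cM ntM.
have := cyclic_pgroup_Aut_structure pM cM ntM; rewrite /= hodd.
by case=> f [_ [_ cF _ _]]; case: ifP => [_ -> //|_ [t [_ _ _ [[]]]]].
Qed.

(** Restriction to the characteristic subgroup [M] of order [p ^ m] is injective, and [Aut M] is
    cyclic since [p] is odd. *)
Lemma Aut_cyclic : cyclic (Aut [set: gT]).
Proof.
case/cyclicP: (cG) => x defG.
have ox : #[x] = (2 * p ^ m)%N by rewrite orderE -defG cardsT.
have p0 := prime_gt0 hp.
have pm1 : (1 < p ^ m)%N by rewrite -(expn0 p) ltn_exp2l ?prime_gt1.
pose M := <[x ^+ 2]>%G.
have cM : #|M| = (p ^ m)%N.
  by rewrite -orderE orderXdiv ox ?dvdn_mulr // mulKn.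
have charM : M \char [set: gT] by rewrite defG cycle_subgroup_char ?cycleX.
have cycM : cyclic (Aut M).
  apply: Aut_pgroup_cyclic; rewrite ?cycle_cyclic //.
    by rewrite /pgroup cM pnatX pnat_id.
  by rewrite -cardG_gt1 cM.
have sN : Aut [set: gT] \subset 'N(M | 'P).
  apply/subsetP=> a Aa; rewrite !inE /=; apply/subsetP=> y My; rewrite inE /= apermE.
  have /charP[_ hM] := charM.
  rewrite -(hM (autm_morphism Aa)) ?injm_autm ?im_autm //.
  by rewrite -(autmE Aa) mem_morphim ?inE.
(* With trivial kernel, the whole group is isomorphic to its image by restriction, a subgroup of the
   cyclic [Aut M]. *)
suff triv : 'C_(Aut [set: gT])(M | 'P) = 1.
  have := Aut_in_isog [set: gT]%G M.
  rewrite /Aut_in triv /= (setIidPl sN) => iso.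
  have iso2 := isog_trans (quotient1_isog (Aut_group [set: gT])) iso.
  rewrite (isog_cyclic iso2); apply: cyclicS cycM; apply: restr_perm_Aut.
  exact: subsetT.
apply/trivgP/subsetP=> a /setIP[Aa /astabP CMa]; rewrite inE; apply/eqP/permP=> y.
rewrite perm1.
have am := autmE Aa.
have aM : {morph a : u v / u * v} by move=> u v; rewrite -am morphM ?inE.
have aX k : {morph a : u / u ^+ k} by move=> u; rewrite -am morphX ?inE.
have fixM u : u \in M -> a u = u by move/CMa; rewrite /= apermE.
(* [x] is the product of its 2-part, the unique involution, and its 2'-part,
   which lies in [M]. *)
have fixx : a x = x.
  have inM : x.`_(2%N)^' \in M.
    rewrite -cycle_subG -(cardSg_cyclic cG) ?subsetT // -orderE order_constt ox cM.
    rewrite partnM ?expn_gt0 ?p0 // part_p'nat ?pnatNK ?pnat_id // mul1n.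
    exact: dvdn_part.
  have o2 : #[x.`_(2%N)] = 2.
    rewrite order_constt ox partnM ?expn_gt0 ?p0 // part_pnat_id ?pnat_id //.
    rewrite part_p'nat ?muln1 // pnatX p'natE // dvdn2 hodd.
    by [].
  have : a x.`_(2%N) \in <[x.`_(2%N)]>.
    rewrite -(eq_order_cyclic cG (x := a x.`_(2%N))) ?cycle_id //.
    by rewrite -am order_injm ?injm_autm ?inE.
  rewrite cycle2g // !inE => /orP[/eqP a1|/eqP ex].
    have : x.`_(2%N) = 1 by apply: (@perm_inj _ a); rewrite a1 -am morph1.
    by move=> e; rewrite e order1 in o2.
  by rewrite -(consttC 2%N x) aM ex fixM.
have : y \in <[x]> by rewrite -defG inE.
by case/cycleP=> k ->; rewrite aX fixx.
Qed.

Lemma card_Aut_twice : #|Aut [set: gT]| = totient (p ^ m).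
Proof.
by rewrite card_Aut_cyclic // cardsT cgT totient_double // oddX hodd orbT.
Qed.

Lemma even_totient_ppow : (2 %| totient (p ^ m))%N.
Proof.
rewrite totient_pfactor // dvdn_mulr // dvdn2.
by rewrite -subn1 oddB ?prime_gt0 // hodd.
Qed.

Definition inv_perm : {perm gT} := perm (@invg_inj gT).

Lemma inv_perm_Aut : inv_perm \in Aut [set: gT].
Proof.
rewrite inE; apply/andP; split; first by apply/subsetP=> x; rewrite inE.
apply/morphicP=> x y _ _; rewrite !permE invMg.
by apply: (centsP (cyclic_abelian cG)); rewrite inE.
Qed.

(** Inversion is not the identity because it moves an element of order [p], an odd prime. *)
Lemma order_inv_perm : #[inv_perm] = 2.
Proof.
have [x ox] : exists x : gT, #[x] = p.
  apply: exists_order => //; rewrite cgT dvdn_mull //.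
  by rewrite -[X in (X %| _)%N]expn1 dvdn_exp2l.
apply: nt_prime_order => //.
  by apply/permP=> y; rewrite expgS expg1 permM perm1 !permE invgK.
apply/eqP=> /permP/(_ x); rewrite perm1 permE => xV.
have : (#[x] %| 2)%N by rewrite order_dvdn expgS expg1 -{1}xV mulVg.
by rewrite ox dvdn_prime2 // => /eqP p2; move: hodd; rewrite p2.
Qed.

(** The join is a product of subgroups of orders [N %/ gcdn N i] and 2 in a cyclic group, so its
    order is their lcm. *)
Lemma index_joing_inv_perm w i : Aut [set: gT] = <[w]> ->
  #|Aut [set: gT] : <[w ^+ i]> <*> <[inv_perm]>|
   = gcdn i (totient (p ^ m) %/ 2).
Proof.
move=> defA; set N := totient (p ^ m).
have N0 : (0 < N)%N by rewrite totient_gt0 expn_gt0 prime_gt0.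
have oN : #[w] = N by rewrite orderE -defA card_Aut_twice.
have e2 := even_totient_ppow; rewrite -/N in e2.
have h20 : (0 < N %/ 2)%N by rewrite divn_gt0 // dvdn_leq.
have sI : <[inv_perm]> \subset Aut [set: gT] by rewrite cycle_subG inv_perm_Aut.
have sw : <[w ^+ i]> \subset Aut [set: gT] by rewrite defA cycleX.
have sJ : <[w ^+ i]> <*> <[inv_perm]> \subset Aut [set: gT] by rewrite join_subG sw.
have cA := Aut_cyclic.
have cJ : #|<[w ^+ i]> <*> <[inv_perm]>| = (N %/ gcdn i (N %/ 2))%N.
  rewrite norm_joinEl; last first.
    apply: cents_norm; apply: subset_trans sw _.
    apply: subset_trans (cyclic_abelian cA) _.
    exact: centS.
  rewrite (card_mul_cyclic cA) // -!orderE order_inv_perm orderXgcd oN.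
  (* Writing 2 as the complementary divisor of [N %/ 2] makes [lcmn_div] applicable. *)
  have two : (N %/ (N %/ 2) = 2)%N by rewrite divnA // mulKn.
  rewrite -[X in lcmn _ X]two.
  rewrite lcmn_div ?dvdn_gcdl ?dvdn_div //.
  congr (_ %/ _)%N; rewrite gcdnAC gcdnC.
  by rewrite (gcdn_idPr (dvdn_div e2)).
have g0 : (0 < gcdn i (N %/ 2))%N by rewrite gcdn_gt0 h20 orbT.
have gN : (gcdn i (N %/ 2) %| N)%N.
  by rewrite (dvdn_trans (dvdn_gcdr _ _)) // dvdn_div.
by rewrite -divgS // cJ card_Aut_twice -/N divnA // mulKn.
Qed.

End AutCyclic.

(** * Divisibility with an odd cofactor and divisors of 2p^m *)

(** The left gcd divides both [a * r] and [a * 2], whose gcd is [a] as [r] is odd. This replaces a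
    totient by its half in gcds with [d]. *)
Lemma gcdn_double_odd d a r :
  odd r -> (d %| a * r)%N -> gcdn d (2 * a) = gcdn d a.
Proof.
move=> or dar; apply/eqP; rewrite eqn_dvd !dvdn_gcd !dvdn_gcdl /=.
rewrite [X in _ && X](dvdn_mull _ (dvdn_gcdr _ _)) andbT.
have co : coprime r 2 by rewrite coprimen2.
have aE : a = gcdn (a * r) (a * 2) by rewrite -muln_gcdr (eqP co) muln1.
rewrite [X in (_ %| X)%N]aE dvdn_gcd.
by rewrite (dvdn_trans (dvdn_gcdl _ _) dar) [(a * 2)%N]mulnC dvdn_gcdr.
Qed.

(** A proper divisor of [2 * p ^ m] is either odd, hence divides [p ^ m], or equals [2 * p ^ i] with
    [i < m]. *)
Lemma dvdn_twice_ppow p m k : prime p -> odd p -> (0 < m)%N ->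
    (k %| 2 * p ^ m)%N ->
  (k == 2 * p ^ m)%N = ~~ (k %| p ^ m)%N && ~~ (k %| 2 * p ^ m.-1)%N.
Proof.
move=> hp hodd hm kn; have p1 := prime_gt1 hp.
apply/eqP/andP => [->|[k1 k2]].
  split; first by rewrite gtnNdvd ?expn_gt0 ?prime_gt0 // ltn_Pmull ?expn_gt0 ?prime_gt0.
  by rewrite dvdn_pmul2l // dvdn_Pexp2l // -ltnNge prednK.
have : ~~ odd k.
  by apply: contra k1 => ok; rewrite -(@Gauss_dvdr _ 2) // coprimen2.
rewrite -dvdn2 => /dvdnP[l kl]; move: kn k2; rewrite kl mulnC !dvdn_pmul2l //.
case/(dvdn_pfactor _ _ hp)=> i li ->; rewrite dvdn_Pexp2l // -ltnNge => ltm.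
by congr (_ * _ ^ _)%N; apply/eqP; rewrite eqn_leq li -(prednK hm).
Qed.

(** * Cauchy-Frobenius for the action on connection sets *)

Section Burnside.
Local Open Scope group_scope.
Variable gT : finGroupType.

Lemma acts_Gset k :
  [acts Aut [set: gT], on [set Om in Gset gT | #|Om| == k]%N | 'P^*].
Proof.
apply/subsetP=> a Aa; rewrite !inE; apply/subsetP=> Om; rewrite !inE /=.
case/andP=> /and3P[/eqP VOm /eqP gOm nOm] cOm.
have -> : setact 'P Om a = autm Aa @* Om.
  by rewrite morphimEsub ?subsetT //; apply: eq_imset => x.
rewrite card_injm ?injm_autm ?subsetT // cOm andbT -morphimV ?VOm ?eqxx /=.
rewrite -morphim_gen ?subsetT // gOm im_autm eqxx /=.
apply: contra nOm => /morphimP[x _ Ox e].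
have /(injmP (injm_autm Aa)) : autm Aa 1 = autm Aa x by rewrite -e morph1.
by move=> ->; rewrite ?inE.
Qed.

Hypothesis ntG : [set: gT] != 1.

(** Orbit counting is applied in each degree [k]; exchanging the sums then collects the fixed sets
    of each automorphism. *)
Lemma Psiw_Burnside :
  (#|Aut [set: gT]|%:R *: Psiw gT =
  \sum_(a in Aut [set: gT]) \sum_(Om in 'Fix_(Gset gT | 'P^*)[a]) 'X^#|Om|)%R.
Proof.
rewrite /Psiw scaler_sumr.
transitivity (\sum_(1 <= k < #|gT|) \sum_(a in Aut [set: gT])
    \sum_(Om in 'Fix_(Gset gT | 'P^*)[a] | k == #|Om|) 'X^k : {poly rat})%R.
  apply: eq_bigr => k _.
  rewrite scalerA -natrM mulnC -(Frobenius_Cauchy (acts_Gset k)).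
  rewrite natr_sum scaler_suml; apply: eq_bigr => a _.
  rewrite sumr_const scaler_nat; congr (_ *+ _)%R; apply: eq_card => Om.
  by rewrite [RHS]unfold_in !inE [k == _]eq_sym andbAC.
rewrite exchange_big; apply: eq_bigr => a _ /=.
rewrite (exchange_big_dep (mem 'Fix_(Gset gT | 'P^*)[a])) //=; last first.
  by move=> k Om _ /andP[].
apply: eq_bigr => Om OmF; under eq_bigl do rewrite OmF /=.
(* No size falls outside the summation range: a generating set of a nontrivial group is nonempty,
   and omitting 1 makes it proper. *)
rewrite big_nat1_eq ifT //.
move: OmF; rewrite !inE => /andP[/and3P[_ /eqP gOm nOm] _].
apply/andP; split.
  by rewrite card_gt0; apply: contraNneq ntG => e; rewrite -gOm e gen0.
by rewrite -cardsT; apply: proper_card; apply/properP; split;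
  [exact: subsetT | exists 1; rewrite ?inE].
Qed.

End Burnside.

Lemma sum_cycle (V : nmodType) (gT : finGroupType) (w : gT) (F : gT -> V) :
  \sum_(a in <[w]>%g) F a = \sum_(0 <= i < #[w]%g) F (w ^+ i)%g.
Proof.
rewrite big_mkord -(big_imset (h := fun i : 'I_#[w]%g => (w ^+ i)%g) F) /=; last first.
  move=> i j _ _ /eqP; rewrite eq_expg_mod_order !modn_small // => /eqP.
  exact: val_inj.
apply: eq_bigl => a; apply/cycleP/imsetP => [[i ->]|[i _ ->]]; last by exists i.
exists (Ordinal (ltn_pmod i (order_gt0 w))) => //=.
by rewrite expg_mod_order.
Qed.

(** * Inclusion-exclusion for the connection sets fixed by an automorphism *)

Section Counting.
Local Open Scope group_scope.
Variables (p m : nat).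
Hypotheses (hp : prime p) (hodd : odd p) (hm : (0 < m)%N).
Variable gT : finGroupType.
Hypothesis cG : cyclic [set: gT].
Hypothesis cgT : #|gT| = (2 * p ^ m)%N.

(** Both sides say that [Om] avoids 1 and lies in the subgroup [<[y]>] of order [t]. *)
Lemma sub_dvd_orders (Om : {set gT}) t : (t %| #|gT|)%N ->
  (Om \subset dvd_orders gT t) = (1 \notin Om) && (#|<<Om>>| %| t)%N.
Proof.
move=> tn; have [y oy] := exists_order cG tn.
rewrite -oy orderE (cardSg_cyclic cG) ?subsetT // gen_subG -orderE.
apply/subsetP/andP => [sO|[n1 /subsetP sO] x xO].
  split; first by apply/negP=> /sO; rewrite !inE eqxx.
  apply/subsetP=> x /sO; rewrite inE oy => /andP[_].
  by rewrite -oy -cycle_subG -(cardSg_cyclic cG) ?subsetT // -!orderE.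
rewrite inE oy; apply/andP; split; first by apply: contraNneq n1 => <-.
by rewrite -oy !orderE (cardSg_cyclic cG) ?subsetT // cycle_subG sO.
Qed.

(* The maximal subgroups have orders [p ^ m] and [2 * p ^ m.-1]. *)
Lemma Gset_dvd_orders (Om : {set gT}) :
  (Om \in Gset gT) =
  [&& Om^-1 == Om, Om \subset dvd_orders gT #|gT|,
      ~~ (Om \subset dvd_orders gT (p ^ m)) &
      ~~ (Om \subset dvd_orders gT (2 * p ^ m.-1))].
Proof.
have tn1 : (p ^ m %| #|gT|)%N by rewrite cgT dvdn_mull.
have tn2 : (2 * p ^ m.-1 %| #|gT|)%N by rewrite cgT dvdn_pmul2l // dvdn_exp2l // leq_pred.
have gn : (#|<<Om>>| %| #|gT|)%N by rewrite -cardsT cardSg ?subsetT.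
rewrite inE !sub_dvd_orders // gn andbT; congr (_ && _).
case: (1 \notin Om); rewrite ?andbF //= andbT.
by rewrite eqEcard subsetT cardsT -dvdn_twice_ppow // -cgT // eqn_leq max_card.
Qed.

Variables (R : comNzRingType) (z : R) (a : {perm gT}).
Hypothesis Aa : a \in Aut [set: gT].
Let H := (<[a]> <*> <[inv_perm gT]>)%G.
Let gf t := stable_gf z 'P H (dvd_orders gT t).

(** Symmetry of [Om] is stability under [inv_perm]; together with being fixed by [a], it amounts to
    stability under [H]. *)
Lemma fixed_Gset (Om : {set gT}) :
  (Om \in 'Fix_(Gset gT | 'P^*)[a]) =
  [&& Om \subset dvd_orders gT #|gT|, [acts H, on Om | 'P],
      ~~ (Om \subset dvd_orders gT (p ^ m)) &
      ~~ (Om \subset dvd_orders gT (2 * p ^ m.-1))].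
Proof.
have -> : [acts H, on Om | 'P] = (('P^*)%act Om a == Om) && (Om^-1 == Om).
  rewrite join_subG !cycle_subG /= -!astab1_set; congr (_ && _).
    by apply/astab1P/eqP.
  apply/astab1P/eqP => [fO|VO].
    apply/setP=> x; rewrite mem_invg -{1}fO.
    apply/imsetP/idP => [[y Oy]|xO]; first by rewrite /= apermE permE => /invg_inj ->.
    by exists x; rewrite //= apermE permE.
  rewrite -[RHS]VO; apply/setP=> x; rewrite mem_invg.
  apply/imsetP/idP => [[y Oy ->]|xO]; first by rewrite /= apermE permE invgK.
  by exists x^-1; rewrite //= apermE permE invgK.
rewrite inE Gset_dvd_orders (sameP afix1P eqP).
by case: (Om^-1 == Om); case: (_ == Om); rewrite ?andbF ?andbT.
Qed.

Lemma sum_fixed_Gset :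
  (\sum_(Om in 'Fix_(Gset gT | 'P^*)[a]) z ^+ #|Om|
   = gf #|gT| - gf (p ^ m) - gf (2 * p ^ m.-1) + gf (p ^ m.-1))%R.
Proof.
have tn1 : (p ^ m %| #|gT|)%N by rewrite cgT dvdn_mull.
have tn2 : (2 * p ^ m.-1 %| #|gT|)%N by rewrite cgT dvdn_pmul2l // dvdn_exp2l // leq_pred.
have tn3 : (p ^ m.-1 %| #|gT|)%N by rewrite (dvdn_trans _ tn2) // dvdn_mull.
pose P (Om : {set gT}) := (Om \subset dvd_orders gT #|gT|) && [acts H, on Om | 'P].
pose A (Om : {set gT}) := Om \subset dvd_orders gT (p ^ m).
pose B (Om : {set gT}) := Om \subset dvd_orders gT (2 * p ^ m.-1).
have sub t (Om : {set gT}) : (t %| #|gT|)%N ->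
    (Om \subset dvd_orders gT t) = 
    (Om \subset dvd_orders gT #|gT|) && (Om \subset dvd_orders gT t).
  move=> tn; apply/idP/andP => [sO|[]//]; split=> //.
  apply: (subset_trans sO); apply/subsetP=> x; rewrite !inE => /andP[-> /=].
  by move/dvdn_trans; apply.
(* The two maximal subgroups meet in the subgroup whose order is the gcd of theirs. *)
have AB (Om : {set gT}) : (Om \subset dvd_orders gT (p ^ m.-1)) = A Om && B Om.
  rewrite /A /B !sub_dvd_orders //; case: (1 \notin Om) => //=.
  have pE : (p ^ m.-1 = gcdn (p ^ m) (2 * p ^ m.-1))%N.
    rewrite Gauss_gcdr ?coprimen2 ?oddX ?hodd ?orbT //.
    by apply/esym/gcdn_idPr; rewrite dvdn_exp2l ?leq_pred.
  by rewrite {1}pE dvdn_gcd.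
have gfE t (C : pred {set gT}) : (t %| #|gT|)%N ->
    (forall Om : {set gT}, (Om \subset dvd_orders gT t) = C Om) ->
    (gf t = \sum_(Om | P Om && C Om) z ^+ #|Om|)%R.
  move=> tn CE; apply: eq_bigl => Om; rewrite sub // CE /P.
  by rewrite andbAC.
rewrite (gfE #|gT| (fun Om => Om \subset dvd_orders gT #|gT|)) //.
rewrite (gfE _ A) // (gfE _ B) // (gfE _ (fun Om => A Om && B Om)) //.
have -> : (\sum_(Om | P Om && (Om \subset dvd_orders gT #|gT|)) z ^+ #|Om|
           = \sum_(Om | P Om) z ^+ #|Om|)%R.
  by apply: eq_bigl => Om; rewrite /P andbAC andbb.
have -> : (\sum_(Om in 'Fix_(Gset gT | 'P^*)[a]) z ^+ #|Om|
    = \sum_(Om | P Om && ~~ A Om && ~~ B Om) z ^+ #|Om|)%R.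
  by apply: eq_bigl => Om; rewrite fixed_Gset /P -!andbA.
rewrite [(\sum_(Om | P Om) _)%R](bigID A) /=.
rewrite [(\sum_(Om | P Om && ~~ A Om) _)%R](bigID B) /=.
rewrite [(\sum_(Om | P Om && B Om) _)%R](bigID A) /=.
under [(\sum_(Om | P Om && B Om && A Om) _)%R]eq_bigl do rewrite -andbA [B _ && _]andbC.
under [(\sum_(Om | P Om && B Om && ~~ A Om) _)%R]eq_bigl do rewrite andbAC.
by ring.
Qed.

End Counting.

(** * Identification of the factors with [Ud] and [Pd] *)

Section Factors.
Variables (p m d : nat).
Hypotheses (hp : prime p) (hodd : odd p) (hm : (0 < m)%N).
Hypothesis hd : (d %| totient (p ^ m) %/ 2)%N.

(** The odd cofactor is [p ^ k]: multiplying the half-totient of [p ^ (m - k)] by it gives that of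
    [p ^ m], a multiple of [d]. *)
Lemma gcdn_totient_gk k : (k < m)%N -> gcdn d (totient (p ^ (m - k))) = gk p m k d.
Proof.
move=> km; have e2 := even_totient_ppow hp hodd.
have mk : (0 < m - k)%N by rewrite subn_gt0.
rewrite -[in LHS](divnK (e2 _ mk)) mulnC /gk.
apply: (@gcdn_double_odd _ _ (p ^ k)); first by rewrite oddX hodd orbT.
move: hd; congr (_ %| _)%N; rewrite divn_mulAC ?e2 //; congr (_ %/ _)%N.
rewrite !totient_pfactor // -mulnA -expnD; congr (_ * _ ^ _)%N.
by rewrite -!subn1 addnBAC // subnK // ltnW.
Qed.

Lemma order_factor_Ud : order_factor 'X d (p ^ m) = Ud p m d.
Proof.
have dN : (d %| totient (p ^ m))%N.
  by rewrite (dvdn_trans hd) // dvdn_div // even_totient_ppow.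
by rewrite /order_factor (gcdn_idPl dN).
Qed.

(** [Pd] lists the exponents [m - k] downwards from [m.-1] to 1, so the product is reversed. *)
Lemma prod_order_factor_Pd :
  \prod_(0 <= i < m.-1) order_factor 'X d (p ^ i.+1) = Pd p m d.
Proof.
rewrite /Pd big_add1 big_nat_rev /= add0n; apply: eq_big_nat => i /andP[_ lti].
have lti' : (i.+1 < m)%N by rewrite -(prednK hm).
rewrite -(gcdn_totient_gk lti') /order_factor.
suff -> : (m.-1 - i.+1).+1 = (m - i.+1)%N by [].
by rewrite -{2}(prednK hm) subSn.
Qed.

Lemma horner_Ud : (Ud p m d).[1] = (2 ^ d)%:R.
Proof. by rewrite /Ud horner_exp !hornerE expr1n natrX. Qed.

Lemma horner_Pd : (Pd p m d).[1] = (\prod_(1 <= k < m) 2 ^ gk p m k d)%:R.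
Proof.
rewrite /Pd horner_prod natr_prod; apply: eq_bigr => k _.
by rewrite horner_exp !hornerE expr1n natrX.
Qed.

End Factors.

(** * Assembly of the series and its value at 1 *)

Lemma Psiw_cyclic_twice (p m : nat) (gT : finGroupType) :
    prime p -> odd p -> (0 < m)%N -> cyclic [set: gT] -> #|gT| = (2 * p ^ m)%N ->
  Psiw gT =
    (2%:R / (totient (p ^ m))%:R) *:
      \sum_(d <- divisors (totient (p ^ m) %/ 2))
        (totient (totient (p ^ m) %/ (2 * d)))%:R *:
          ((Ud p m d - 1) * Ud p m d * Pd p m d ^+ 2 * (1 + 'X)
           + (Ud p m d - 1) * (Pd p m d * (1 + 'X) - 1) * Pd p m d).
Proof.
move=> hp hodd hm cG cgT; set N := totient (p ^ m).
have p0 := prime_gt0 hp.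
have N0 : (0 < N)%N by rewrite totient_gt0 expn_gt0 p0.
have e2 : (2 %| N)%N := even_totient_ppow hp hodd hm.
have h20 : (0 < N %/ 2)%N by rewrite divn_gt0 // dvdn_leq.
have cA := Aut_cyclic hp hodd hm cG cgT.
have cardA : #|Aut [set: gT]| = N := card_Aut_twice hodd cG cgT.
case/cyclicP: (cA) => w defA.
have ow : #[w]%g = N by rewrite orderE -defA cardA.
have ntG : [set: gT] != 1%g.
  by rewrite -cardG_gt1 cardsT cgT (leq_trans _ (leq_pmulr _ _)) // expn_gt0 p0.
pose F d : {poly rat} := (Ud p m d - 1) * Ud p m d * Pd p m d ^+ 2 * (1 + 'X)
           + (Ud p m d - 1) * (Pd p m d * (1 + 'X) - 1) * Pd p m d.
have key : N%:R *: Psiw gT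
    = (\sum_(d <- divisors (N %/ 2)) F d *+ totient (N %/ 2 %/ d)) *+ 2.
  (* The divisor sum is unfolded into a sum over exponents [i < N] of the generator [w], to be
     matched term by term with the Burnside sum. *)
  rewrite -sum_gcdn_double // -{1}cardA Psiw_Burnside // [in LHS]defA sum_cycle ow.
  rewrite -muln2 divnK //; apply: eq_bigr => i _.
  have Ai : (w ^+ i)%g \in Aut [set: gT] by rewrite defA mem_cycle.
  rewrite (sum_fixed_Gset hp hodd hm cG cgT) //.
  have sH : ((<[w ^+ i]> <*> <[inv_perm gT]>)%G \subset Aut [set: gT])%g.
    by rewrite join_subG !cycle_subG Ai inv_perm_Aut.
  have tn2 : (2 * p ^ m.-1 %| #|gT|)%N.
    by rewrite cgT dvdn_pmul2l // dvdn_exp2l // leq_pred.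
  rewrite [in X in X - _ - _ + _]cgT.
  rewrite !stable_gf_2ppow ?stable_gf_ppow // ?cgT //; last first.
  - by rewrite dvdn_mull // dvdn_exp2l // leq_pred.
  - by rewrite dvdn_mull // dvdn_exp2l // leq_pred.
  rewrite (index_joing_inv_perm hp hodd hm cG cgT i defA) -/N.
  set d := gcdn i _; have hd : (d %| N %/ 2)%N by rewrite dvdn_gcdr.
  (* The last factor, for elements of order [p ^ m], is split off as [Ud]; the lower powers of [p]
     form [Pd]. *)
  have -> : \prod_(0 <= j < m) order_factor 'X d (p ^ j.+1) = Pd p m d * Ud p m d.
    rewrite -{1}(prednK hm) big_nat_recr //= prednK //.
    by rewrite prod_order_factor_Pd // order_factor_Ud.
  by rewrite prod_order_factor_Pd // /F; ring.
have Nn0 : N%:R != 0 :> rat by rewrite Num.Theory.pnatr_eq0 -lt0n.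
have -> : Psiw gT = N%:R^-1 *: (N%:R *: Psiw gT) by rewrite scalerA mulVf ?scale1r.
rewrite key -scaler_nat scalerA mulrC.
congr (_ *: _); apply: eq_bigr => d _.
by rewrite scaler_nat divnMA.
Qed.

Unset Implicit Arguments.

Theorem theorem4p4 (p m : nat) (hp : prime p) (hodd : odd p) (hm : (1 <= m)%N) :
  Psiw ('Z_(2 * p ^ m) : finGroupType) =
    (2%:R / (p ^ m.-1 * (p - 1))%N%:R) *:
      \sum_(d <- divisors (totient (p ^ m) %/ 2))
        (totient (totient (p ^ m) %/ (2 * d)))%:R *:
          ((Ud p m d - 1) * Ud p m d * Pd p m d ^+ 2 * (1 + 'X)
           + (Ud p m d - 1) * (Pd p m d * (1 + 'X) - 1) * Pd p m d)
  /\
  Ew ('Z_(2 * p ^ m) : finGroupType) =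
    (2%:R / (p ^ m.-1 * (p - 1))%N%:R) *
      \sum_(d <- divisors (totient (p ^ m) %/ 2))
        (totient (totient (p ^ m) %/ (2 * d)))%:R *
          ((2 ^ d.+1 * (2 ^ d - 1) * \prod_(1 <= k < m) 2 ^ (2 * gk p m k d))%N%:R
           + ((2 ^ d)%N%:R - 1) * (2 * (\prod_(1 <= k < m) 2 ^ gk p m k d)%N%:R - 1)
             * (\prod_(1 <= k < m) 2 ^ gk p m k d)%N%:R).
Proof.
have p0 := prime_gt0 hp.
have n1 : (1 < 2 * p ^ m)%N by rewrite (leq_trans _ (leq_pmulr _ _)) // expn_gt0 p0.
have cG : cyclic [set: 'Z_(2 * p ^ m)].
  by apply/cyclicP; exists Zp1; rewrite -Zp_cycle.
have cgT : #|'Z_(2 * p ^ m)| = (2 * p ^ m)%N by rewrite card_ord Zp_cast.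
have Psi := Psiw_cyclic_twice hp hodd hm cG cgT.
have -> : (p ^ m.-1 * (p - 1) = totient (p ^ m))%N.
  by rewrite totient_pfactor // mulnC subn1.
split=> //; rewrite /Ew Psi hornerZ horner_sum; congr (_ * _).
apply: eq_bigr => d _; rewrite hornerZ; congr (_ * _).
move: (horner_Ud p m d) (horner_Pd p m d); move: (Ud p m d) (Pd p m d) => U P hU hP.
rewrite !(hornerD, hornerN, hornerM, horner_exp, hornerX, hornerC) hU hP.
have -> : (\prod_(1 <= k < m) 2 ^ (2 * gk p m k d)
           = (\prod_(1 <= k < m) 2 ^ gk p m k d) ^ 2)%N.
  by rewrite -mulnn -big_split; apply: eq_bigr => k _; rewrite mul2n -addnn expnD.
(* The truncated subtraction [2 ^ d - 1] becomes a genuine one in the rationals because [2 ^ d] is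
   positive. *)
rewrite !natrM natrB ?expn_gt0 // !natrX exprS.
by ring.
Qed.
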